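(* Let $p\ge 5$ be a prime, let $\mathcal{N}$ be the Nottingham group over $\mathbb{F}_p$, and let $k\ge 1$. Then the quotient $\mathcal{N}/\mathcal{N}_k$ is a Beauville group if and only if $k\ge 3$ and $k\ne z_m$ for all $m\ge 1$.
   Context: The Nottingham group $\mathcal{N}$ over $\mathbb{F}_p$ is the group, under composition, of normalised automorphisms of the ring $\mathbb{F}_p[[t]]$; each $f\in\mathcal{N}$ is completely determined by $f(t)=t+\sum_{i\ge 2}a_it^i$, with $a_i\in\mathbb{F}_p$ (all such series occur). For $k\ge 1$, $\mathcal{N}_k$ is the normal subgroup of all $f\in\mathcal{N}$ with $f(t)=t+\sum_{i\ge k+1}a_it^i$. For $m\ge 1$, $z_m=p^m+p^{m-1}+\cdots+p+2$. For elements $x,y$ of a finite group $G$ let $\Sigma(x,y)=\bigcup_{g\in G}\big(\langle x\rangle^g\cup\langle y\rangle^g\cup\langle xy\rangle^g\big)$. A Beauville structure for $G$ is a pair of generating sets $\{x_1,y_1\}$, $\{x_2,y_2\}$ of $G$ such that $\Sigma(x_1,y_1)\cap\Sigma(x_2,y_2)=1$. $G$ is a Beauville group if it has a Beauville structure. By convention the groups considered are non-trivial (the trivial quotient $\mathcal{N}/\mathcal{N}_1$ is not regarded as a Beauville group). *)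

(* Defs.v *)
From HB Require Import structures.
From mathcomp Require Import all_boot all_order all_algebra all_fingroup.
From mathcomp Require Import boolp.

Set Implicit Arguments.
Unset Strict Implicit.
Unset Printing Implicit Defensive.

Import GRing.Theory.
Local Open Scope quotient_scope.

(* fingroup.repr shadows this one. *)
Local Notation repr := generic_quotient.repr.

Section PowerSeries.
Local Open Scope ring_scope.

Record fps (R : Type) := Fps { fps_coef : nat -> R }.

HB.instance Definition _ (R : Type) := gen_eqMixin (fps R).
HB.instance Definition _ (R : Type) := gen_choiceMixin (fps R).

Lemma fpsP (R : Type) (a b : fps R) :
  (forall n, fps_coef a n = fps_coef b n) -> a = b.
Proof. by case: a b => a [b] /= h; congr Fps; apply/funext. Qed.

Variable R : comNzRingType.
Implicit Types a b c : fps R.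

Definition fps_add a b := Fps (fun n => fps_coef a n + fps_coef b n).
Definition fps_opp a := Fps (fun n => - fps_coef a n).
Definition fps_zero : fps R := Fps (fun=> 0).
Definition fps_const (x : R) : fps R := Fps (fun n => if n == 0 then x else 0).
Definition fps_mul a b :=
  Fps (fun n => \sum_(i < n.+1) fps_coef a i * fps_coef b (n - i)).

Lemma fps_addA : associative fps_add.
Proof. by move=> a b c; apply: fpsP => n; rewrite /= addrA. Qed.
Lemma fps_addC : commutative fps_add.
Proof. by move=> a b; apply: fpsP => n; rewrite /= addrC. Qed.
Lemma fps_add0 : left_id fps_zero fps_add.
Proof. by move=> a; apply: fpsP => n; rewrite /= add0r. Qed.
Lemma fps_addN : left_inverse fps_zero fps_opp fps_add.
Proof. by move=> a; apply: fpsP => n; rewrite /= addNr. Qed.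

HB.instance Definition _ :=
  GRing.isZmodule.Build (fps R) fps_addA fps_addC fps_add0 fps_addN.

Definition fps_trunc n a : {poly R} := \poly_(i < n.+1) fps_coef a i.

Lemma coef_fps_trunc n a i : (i <= n)%N -> (fps_trunc n a)`_i = fps_coef a i.
Proof. by move=> le_in; rewrite coef_poly ltnS le_in. Qed.

Lemma coef_fps_mul n a b i : (i <= n)%N ->
  fps_coef (fps_mul a b) i = (fps_trunc n a * fps_trunc n b)`_i.
Proof.
move=> le_in; rewrite coefM; apply: eq_bigr => j _.
by rewrite !coef_fps_trunc ?(leq_trans (leq_subr _ _)) // (leq_trans _ le_in) // -ltnS.
Qed.

Lemma fps_mulC : commutative fps_mul.
Proof. by move=> a b; apply: fpsP => n; rewrite !(coef_fps_mul _ _ (leqnn n)) mulrC. Qed.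

Lemma fps_mulA : associative fps_mul.
Proof.
have aux a b c n : fps_coef (fps_mul (fps_mul a b) c) n =
    (fps_trunc n a * fps_trunc n b * fps_trunc n c)`_n.
  rewrite coefM; apply: eq_bigr => i _; have le_in : (i <= n)%N by rewrite -ltnS.
  by rewrite (coef_fps_mul _ _ le_in) coef_fps_trunc ?leq_subr.
move=> a b c; apply: fpsP => n; rewrite aux fps_mulC aux.
by rewrite mulrC mulrA.
Qed.

Lemma fps_mul1 : left_id (fps_const 1) fps_mul.
Proof.
move=> a; apply: fpsP => n.
by rewrite /= big_ord_recl /= mul1r subn0 big1 ?addr0 // => i _; rewrite mul0r.
Qed.

Lemma fps_mulDl : left_distributive fps_mul fps_add.
Proof.
by move=> a b c; apply: fpsP => n; rewrite /= -big_split; apply: eq_bigr => i _; rewrite /= mulrDl.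
Qed.

Lemma fps_one_neq0 : fps_const 1 != 0.
Proof. by apply/eqP => /(congr1 (fun a => fps_coef a 0)) /= /eqP; rewrite oner_eq0. Qed.

HB.instance Definition _ := GRing.Zmodule_isComNzRing.Build (fps R)
  fps_mulA fps_mulC fps_mul1 fps_mulDl fps_one_neq0.

Definition fpsX : fps R := Fps (fun n => (n == 1)%:R).

Lemma fps_coefD a b n : fps_coef (a + b) n = fps_coef a n + fps_coef b n.
Proof. by []. Qed.
Lemma fps_coefN a n : fps_coef (- a) n = - fps_coef a n.
Proof. by []. Qed.
Lemma fps_coefM a b n :
  fps_coef (a * b) n = \sum_(i < n.+1) fps_coef a i * fps_coef b (n - i).
Proof. by []. Qed.

Lemma fps_coefXM a n :
  fps_coef (fpsX * a) n = if n is m.+1 then fps_coef a m else 0.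
Proof.
case: n => [|n]; first by rewrite fps_coefM big_ord1 /= mul0r.
rewrite fps_coefM !big_ord_recl /= mul0r add0r mul1r subSS subn0.
by rewrite big1 ?addr0 // => i _; rewrite mul0r.
Qed.

Lemma fps_coefXnM k a n :
  fps_coef (fpsX ^+ k * a) n = if (n < k)%N then 0 else fps_coef a (n - k).
Proof.
elim: k n => [|k IHk] n; first by rewrite expr0 mul1r subn0.
by rewrite exprS -mulrA fps_coefXM; case: n => [|n] //; rewrite IHk ltnS subSS.
Qed.

(* a lies in the ideal (t^k). *)
Definition fps_vanish k a := forall i, (i < k)%N -> fps_coef a i = 0.

Lemma fps_vanishP k a : fps_vanish k a <-> exists b, a = fpsX ^+ k * b.
Proof.
split=> [a0|[b -> i lt_ik]]; last by rewrite fps_coefXnM lt_ik.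
exists (Fps (fun n => fps_coef a (n + k)%N)); apply: fpsP => n.
by rewrite fps_coefXnM; case: ltnP => [/a0//|le_kn] /=; rewrite subnK.
Qed.

Lemma fps_vanishD k a b : fps_vanish k a -> fps_vanish k b -> fps_vanish k (a + b).
Proof. by move=> a0 b0 i lt_ik; rewrite fps_coefD a0 ?b0 ?addr0. Qed.

Lemma fps_vanishMl k a b : fps_vanish k a -> fps_vanish k (b * a).
Proof. by move=> /fps_vanishP[c ->]; apply/fps_vanishP; exists (b * c); rewrite mulrCA. Qed.

Lemma fps_split a : exists b, a = fps_const (fps_coef a 0) + fpsX * b.
Proof.
exists (Fps (fun n => fps_coef a n.+1)); apply: fpsP => -[|n];
  by rewrite fps_coefD fps_coefXM /= ?addr0 ?add0r.
Qed.

Lemma fps_const_natr n : fps_const n%:R = n%:R.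
Proof.
elim: n => [|n IHn]; first by apply: fpsP => -[].
by rewrite [in RHS]mulrS -IHn; apply: fpsP => -[|i]; rewrite fps_coefD /= ?addr0 // mulrS.
Qed.

End PowerSeries.

Section Nottingham.
Local Open Scope ring_scope.
Variable p : nat.
Let F := 'F_p.

(* f(t) = t + (terms of degree at least 2) *)
Definition normalised (f : fps F -> fps F) :=
  fps_coef (f (fpsX F)) 0 = 0 /\ fps_coef (f (fpsX F)) 1 = 1.

Definition normalised_automorphism (f : fps F -> fps F) :=
  [/\ GRing.zmod_morphism f, GRing.monoid_morphism f, bijective f & normalised f].

Record nottingham := Nottingham {
  nott_fun :> fps F -> fps F;
  nott_autP : normalised_automorphism nott_fun
}.
Implicit Types f g h : nottingham.

HB.instance Definition _ := gen_eqMixin nottingham.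
HB.instance Definition _ := gen_choiceMixin nottingham.

Lemma nottP f g : nott_fun f =1 nott_fun g -> f = g.
Proof.
case: f g => f fP [g gP] /= /funext eq_fg; rewrite -{}eq_fg in gP *.
by congr Nottingham; apply: Prop_irrelevance.
Qed.

Fact nott_zmod f : GRing.zmod_morphism (nott_fun f).
Proof. by case: (nott_autP f). Qed.
Fact nott_monoid f : GRing.monoid_morphism (nott_fun f).
Proof. by case: (nott_autP f). Qed.
HB.instance Definition _ f :=
  GRing.isZmodMorphism.Build (fps F) (fps F) (nott_fun f) (nott_zmod f).
HB.instance Definition _ f :=
  GRing.isMonoidMorphism.Build (fps F) (fps F) (nott_fun f) (nott_monoid f).

Lemma normalisedP (f : fps F -> fps F) :
  normalised f <-> fps_vanish 2 (f (fpsX F) - fpsX F).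
Proof.
split=> [[f0 f1] [|[|]] // _|f0].
- by rewrite fps_coefD f0 fps_coefN subrr.
- by rewrite fps_coefD f1 fps_coefN subrr.
by split; apply/subr0_eq; [exact: (f0 0) | exact: (f0 1)].
Qed.

Lemma morph_vanish (f : {rmorphism fps F -> fps F}) k a :
  fps_coef (f (fpsX F)) 0 = 0 -> fps_vanish k a -> fps_vanish k (f a).
Proof.
move=> f0 /fps_vanishP[b ->]; rewrite rmorphM rmorphXn /=.
have [c ->] : exists c, f (fpsX F) = fpsX F ^+ 1 * c.
  by apply/fps_vanishP => -[].
by apply/fps_vanishP; exists (c ^+ k * f b); rewrite expr1 exprMn mulrA.
Qed.

Lemma morph_const (f : {rmorphism fps F -> fps F}) x : f (fps_const x) = fps_const x.
Proof. by rewrite -[x]natr_Zp fps_const_natr rmorph_nat. Qed.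

Lemma morph_congr (f g : {rmorphism fps F -> fps F}) k a :
  fps_coef (f (fpsX F)) 0 = 0 -> fps_coef (g (fpsX F)) 0 = 0 ->
  fps_vanish k (f (fpsX F) - g (fpsX F)) -> fps_vanish k (f a - g a).
Proof.
move=> f0 g0 fg; suff h n : forall a, fps_vanish (minn n k) (f a - g a).
  by have := h k a; rewrite minnn.
elim: n => [|n IHn] {}a; first by rewrite min0n.
have [b ->] := fps_split a.
rewrite !rmorphD /= !morph_const opprD addrACA subrr add0r !rmorphM /=.
have -> : f (fpsX F) * f b - g (fpsX F) * g b =
    f b * (f (fpsX F) - g (fpsX F)) + g (fpsX F) * (f b - g b).
  by rewrite !mulrBr [f b * _]mulrC [f b * _]mulrC addrA subrK.
apply: fps_vanishD; first apply: fps_vanishMl.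
  by move=> i; rewrite leq_min => /andP[_]; apply: fg.
have [c ->] : exists c, g (fpsX F) = fpsX F ^+ 1 * c.
  by apply/fps_vanishP => -[].
have := @fps_vanishMl _ _ _ c (IHn b).
rewrite expr1 -mulrA => v -[|i]; rewrite fps_coefXM // !leq_min ltnS => /andP[lt_in lt_ik].
by apply: v; rewrite leq_min lt_in ltnW.
Qed.

Lemma nottB f a b : f (a - b) = f a - f b.
Proof. exact: raddfB. Qed.

Lemma nott_coef0 f : fps_coef (f (fpsX F)) 0 = 0.
Proof. by case: (nott_autP f) => _ _ _ []. Qed.

Lemma nott_vanish f k a : fps_vanish k a -> fps_vanish k (f a).
Proof. exact/morph_vanish/nott_coef0. Qed.

Fact nott_id_autP : normalised_automorphism idfun.
Proof. by split=> //; exists idfun. Qed.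
Definition nott_id := Nottingham nott_id_autP.

Fact nott_comp_autP f g : normalised_automorphism (nott_fun f \o nott_fun g).
Proof.
split=> [a b||| ].
- by rewrite /= !raddfB.
- by split=> [|a b] /=; rewrite ?rmorph1 ?rmorphM.
- by case: (nott_autP f) (nott_autP g) => _ _ bf _ [_ _ bg _]; apply: bij_comp.
apply/normalisedP; case: (nott_autP f) (nott_autP g) => _ _ _ /normalisedP f2 [_ _ _ /normalisedP g2].
rewrite /= -[f (g _)](subrK (f (fpsX F))) -addrA; apply: fps_vanishD => //.
by rewrite -nottB; apply: nott_vanish.
Qed.
(* (f * g)(a) = f(g(a)). *)
Definition nott_comp f g := Nottingham (nott_comp_autP f g).

Fact nott_inv_subproof f : {g | cancel (nott_fun f) g /\ cancel g (nott_fun f)}.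
Proof. by apply: cid; case: (nott_autP f) => _ _ [g fK gK] _; exists g. Qed.

Fact nott_inv_autP f : normalised_automorphism (sval (nott_inv_subproof f)).
Proof.
case: (nott_inv_subproof f) => g [fK gK] /=; split.
- by move=> a b; apply: (can_inj fK); rewrite raddfB /= !gK.
- split; first by apply: (can_inj fK); rewrite gK rmorph1.
  by move=> a b; apply: (can_inj fK); rewrite rmorphM /= !gK.
- by exists (nott_fun f).
have [b defX] := fps_split (g (fpsX F)); have [c defb] := fps_split b.
have [_ _ _ [f0 f1]] := nott_autP f.
have := gK (fpsX F); rewrite defX defb mulrDr !rmorphD /= morph_const !rmorphM /= morph_const.
set x := fps_coef _ 0; set y := fps_coef b 0 => E.
have [d defd] : exists d, f (fpsX F) = fpsX F * d.
  by have [|d ->] := (fps_vanishP 1 (f (fpsX F))).1; [case | exists d].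
have x0 : x = 0.
  move/(congr1 (fun a => fps_coef a 0)): E.
  by rewrite defd !fps_coefD -!mulrA !fps_coefXM !addr0.
have y1 : y = 1.
  move/(congr1 (fun a => fps_coef a 1)): E; rewrite !fps_coefD.
  have -> : fps_coef (f (fpsX F) * (f (fpsX F) * f c)) 1 = 0.
    by rewrite defd -!mulrA fps_coefXM mulrCA fps_coefXM.
  have -> : fps_coef (f (fpsX F) * fps_const y) 1 = y.
    by rewrite fps_coefM !big_ord_recl big_ord0 /= f0 f1 mul0r mul1r addr0 add0r.
  by rewrite addr0 add0r.
by split=> //; rewrite defX fps_coefD fps_coefXM add0r.
Qed.
Definition nott_inv f := Nottingham (nott_inv_autP f).

Fact nott_compA : associative nott_comp.
Proof. by move=> f g h; apply: nottP. Qed.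
Fact nott_comp1 : left_id nott_id nott_comp.
Proof. by move=> f; apply: nottP. Qed.
Fact nott_1comp : right_id nott_id nott_comp.
Proof. by move=> f; apply: nottP. Qed.
Fact nott_compV : left_inverse nott_id nott_inv nott_comp.
Proof. by move=> f; apply: nottP => a /=; case: (nott_inv_subproof f) => g []. Qed.
Fact nott_Vcomp : right_inverse nott_id nott_inv nott_comp.
Proof. by move=> f; apply: nottP => a /=; case: (nott_inv_subproof f) => g []. Qed.

HB.instance Definition _ := isGroup.Build nottingham
  nott_compA nott_comp1 nott_1comp nott_compV nott_Vcomp.

(* N_k: the f such that f(t) and t have the same coefficients up to t^k. *)
Definition nott_sub (k : nat) : {pred nottingham} := fun f =>
  [forall i : 'I_k.+1, fps_coef (f (fpsX F)) i == fps_coef (fpsX F) i].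

Lemma nott_subP k f :
  reflect (fps_vanish k.+1 (f (fpsX F) - fpsX F)) (f \in nott_sub k).
Proof.
apply: (iffP forallP) => [fk i lt_ik|fk i].
  by rewrite fps_coefD (eqP (fk (Ordinal lt_ik))) fps_coefN subrr.
by apply/eqP/subr0_eq; apply: fk.
Qed.

Lemma nott_mulE f g a : (f * g)%g a = f (g a).
Proof. by []. Qed.
Lemma nott_oneE a : (1%g : nottingham) a = a.
Proof. by []. Qed.

Lemma nott_sub_trivial k f a : f \in nott_sub k -> fps_vanish k.+1 (f a - a).
Proof.
move=> /nott_subP fk.
by apply: (@morph_congr f (1%g : nottingham)) => //; apply: nott_coef0.
Qed.

(* The coset f N_k is determined by f(t) modulo t^(k+1). *)
Lemma nott_sub_congr k f g : ((f^-1 * g)%g \in nott_sub k) =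
  [forall i : 'I_k.+1, fps_coef (f (fpsX F)) i == fps_coef (g (fpsX F)) i].
Proof.
apply/nott_subP/forallP => [fg i|fg].
  rewrite eq_sym; apply/eqP/subr0_eq.
  move: (nott_vanish f fg); rewrite nottB -nott_mulE mulgA mulgV mul1g.
  by apply.
have -> : fpsX F = (f^-1 * f)%g (fpsX F) by rewrite mulVg.
rewrite [in X in _ - X]nott_mulE nott_mulE mulVg nott_oneE -nottB.
apply: nott_vanish => i lt_ik.
by rewrite fps_coefD fps_coefN (eqP (fg (Ordinal lt_ik))) subrr.
Qed.

Fact nott_sub_closed k : group_closed (nott_sub k).
Proof.
have V f : f \in nott_sub k -> (f^-1)%g \in nott_sub k.
  move=> /nott_subP fk; rewrite -[(f^-1)%g]mulg1 nott_sub_congr.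
  apply/forallP => i; rewrite nott_oneE; apply/eqP/subr0_eq; exact: fk.
split=> [|f g /nott_subP fk /V /(@nott_sub_trivial _ _ (fpsX F)) gk].
  by apply/nott_subP; rewrite nott_oneE subrr.
apply/nott_subP; rewrite nott_mulE -[f (_ _)](subrK (f (fpsX F))) -addrA.
by apply: fps_vanishD => //; rewrite -nottB; apply: nott_vanish.
Qed.

Fact nott_sub_normal k f g : f \in nott_sub k -> (f ^ g)%g \in nott_sub k.
Proof.
move=> fk; apply/nott_subP.
have {2}-> : fpsX F = (g^-1 * g)%g (fpsX F) by rewrite mulVg.
rewrite /conjg !nott_mulE -nottB; apply: nott_vanish; exact: nott_sub_trivial.
Qed.

End Nottingham.

(* The quotient type of quotient.v needs a finGroupType, so it does not apply
   to the Nottingham group. *)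

Section Quotient.
Local Open Scope group_scope.

Record normal_subgroup (G : groupType) := NormalSubgroup {
  nsub_pred :> {pred G};
  nsub_group : group_closed nsub_pred;
  nsub_normal : forall x y, x \in nsub_pred -> x ^ y \in nsub_pred
}.

Variables (G : groupType) (N : normal_subgroup G).
Implicit Types x y z : G.

Definition same_coset : rel G := fun x y => x^-1 * y \in (N : {pred G}).

Let N1 : 1 \in (N : {pred G}). Proof. by case: (nsub_group N). Qed.
Let NV : invg_closed (N : {pred G}). Proof. exact/group_closedV/nsub_group. Qed.
Let NM : mulg_closed (N : {pred G}). Proof. exact/group_closedM/nsub_group. Qed.

Fact same_coset_refl : reflexive same_coset.
Proof. by move=> x; rewrite /same_coset mulVg. Qed.
Fact same_coset_sym : symmetric same_coset.
Proof.
suff h x y : same_coset x y -> same_coset y x by move=> x y; apply/idP/idP; apply: h.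
by rewrite /same_coset => /NV; rewrite invgM invgK.
Qed.
Fact same_coset_trans : transitive same_coset.
Proof. by move=> y x z xy yz; have := NM xy yz; rewrite mulgA mulgK. Qed.

Canonical same_coset_equiv :=
  EquivRel same_coset same_coset_refl same_coset_sym same_coset_trans.

Definition quot := {eq_quot same_coset}.
HB.instance Definition _ := Choice.on quot.
HB.instance Definition _ := EqQuotient.on quot.

Lemma quotP x y : reflect (\pi_quot x = \pi_quot y) (same_coset x y).
Proof. exact: (eqmodP same_coset_equiv). Qed.

Definition quot_one : quot := \pi_quot 1.
Definition quot_mul (u v : quot) : quot := \pi_quot (repr u * repr v).
Definition quot_inv (u : quot) : quot := \pi_quot ((repr u)^-1).

Lemma quot_mulE x y : quot_mul (\pi_quot x) (\pi_quot y) = \pi_quot (x * y).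
Proof.
apply/quotP; rewrite /same_coset.
have /quotP hx : \pi_quot (repr (\pi_quot x)) = \pi_quot x by rewrite reprK.
have /quotP hy : \pi_quot (repr (\pi_quot y)) = \pi_quot y by rewrite reprK.
move: (repr _) (repr _) hx hy => y' x'; rewrite /same_coset => hx hy.
rewrite invgM -mulgA [x'^-1 * _]mulgA.
have -> : y'^-1 * (x'^-1 * x * y) = (y'^-1 * y) * (x'^-1 * x) ^ y.
  by rewrite /conjg !mulgA mulgK.
by apply: NM => //; apply: nsub_normal.
Qed.

Lemma quot_invE x : quot_inv (\pi_quot x) = \pi_quot (x^-1).
Proof.
apply/quotP; rewrite /same_coset.
have /quotP hx : \pi_quot (repr (\pi_quot x)) = \pi_quot x by rewrite reprK.
move: (repr _) hx => y; rewrite /same_coset invgK => /NV.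
rewrite invgM invgK => /(nsub_normal x^-1).
by rewrite /conjg invgK !mulgA mulgV mul1g.
Qed.

Lemma quot_ex (u : quot) : exists x, u = \pi_quot x.
Proof. by exists (repr u); rewrite reprK. Qed.

Fact quot_mulA : associative quot_mul.
Proof. by move=> u; have [x ->] := quot_ex u => {u}; move=> u; have [y ->] := quot_ex u => {u}; move=> u; have [z ->] := quot_ex u => {u}; rewrite !quot_mulE mulgA. Qed.
Fact quot_mul1 : left_id quot_one quot_mul.
Proof. by move=> u; have [x ->] := quot_ex u => {u}; rewrite quot_mulE mul1g. Qed.
Fact quot_1mul : right_id quot_one quot_mul.
Proof. by move=> u; have [x ->] := quot_ex u => {u}; rewrite quot_mulE mulg1. Qed.
Fact quot_mulV : left_inverse quot_one quot_inv quot_mul.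
Proof. by move=> u; have [x ->] := quot_ex u => {u}; rewrite quot_invE quot_mulE mulVg. Qed.
Fact quot_Vmul : right_inverse quot_one quot_inv quot_mul.
Proof. by move=> u; have [x ->] := quot_ex u => {u}; rewrite quot_invE quot_mulE mulgV. Qed.

HB.instance Definition _ := isGroup.Build quot
  quot_mulA quot_mul1 quot_1mul quot_mulV quot_Vmul.

End Quotient.

Section NottinghamQuotient.
Variables (p k : nat).

Definition nott_nsub : normal_subgroup (nottingham p) :=
  NormalSubgroup (@nott_sub_closed p k) (@nott_sub_normal p k).

(* N / N_k, as a finGroupType *)
Definition nott_quo := quot nott_nsub.
HB.instance Definition _ := Group.on nott_quo.
HB.instance Definition _ := EqQuotient.on nott_quo.

Definition nott_quo_coef (u : nott_quo) : {ffun 'I_k.+1 -> 'F_p} :=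
  [ffun i : 'I_k.+1 => fps_coef (repr u (fpsX 'F_p)) i].

Lemma nott_quo_coef_inj : injective nott_quo_coef.
Proof.
move=> u v /ffunP eq_uv; rewrite -[u]reprK -[v]reprK; apply/quotP.
rewrite /same_coset nott_sub_congr; apply/forallP => i.
by have := eq_uv i; rewrite !ffunE => ->.
Qed.

Definition nott_quo_decode (c : {ffun 'I_k.+1 -> 'F_p}) : option nott_quo :=
  if pselect (exists u, nott_quo_coef u = c) is left h then Some (sval (cid h))
  else None.

Lemma nott_quo_coefK : pcancel nott_quo_coef nott_quo_decode.
Proof.
move=> u; rewrite /nott_quo_decode; case: pselect => [h|[]]; last by exists u.
by congr Some; apply: nott_quo_coef_inj; case: (cid h).
Qed.

(* Finiteness: by nott_sub_congr, a coset is determined by the k+1 first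
   coefficients of the image of t under any representative. *)
HB.instance Definition _ : isCountable nott_quo := PCanIsCountable nott_quo_coefK.
HB.instance Definition _ : isFinite nott_quo := PCanIsFinite nott_quo_coefK.

End NottinghamQuotient.

Section Beauville.
Local Open Scope group_scope.
Variables (gT : finGroupType) (G : {group gT}).

Definition beauville_Sigma (x y : gT) : {set gT} :=
  \bigcup_(g in G) (<[x]> :^ g :|: <[y]> :^ g :|: <[x * y]> :^ g).

Definition beauville_structure (x1 y1 x2 y2 : gT) : Prop :=
  [/\ <<[set x1; y1]>> = G, <<[set x2; y2]>> = G &
      beauville_Sigma x1 y1 :&: beauville_Sigma x2 y2 = 1].

(* Without the first clause the trivial group would qualify. *)
Definition beauville_group : Prop :=
  G :!=: 1 /\ exists x1 y1 x2 y2, beauville_structure x1 y1 x2 y2.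

End Beauville.

Definition znum (p m : nat) : nat := (\sum_(1 <= i < m.+1) p ^ i + 2)%N.

(* Main.v *)
From HB Require Import structures.
Require Import Defs.
From mathcomp Require Import all_boot all_order all_algebra all_fingroup.
From mathcomp Require Import boolp.
From mathcomp Require Import ring zify.

Set Implicit Arguments.
Unset Strict Implicit.
Unset Printing Implicit Defensive.
Import GRing.Theory.

(** Write e_n, c_n for the first two coefficients of g(t) - t when g lies in N_n,
    those of t^(n+1) and t^(n+2), and replace c_1 by c_1 - e_1^2. Both
    coordinates are then additive on N_n; for n = 1 they identify N / N_3 with
    F_p^2, so an element of N has a direction there. Call it good when neither
    coordinate is zero.

    Everything is read off from the operator delta = g - 1 on F_p[[t]]:
    [delta_coef] gives the two leading coefficients of delta a from those of a.
    There are three consequences.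

    - Since delta^p = g^p - 1 in characteristic p, the p-th power of g in N_n
      with n = 1 mod p lies in N_(pn+1), and its leading coefficient there is
      a nonzero multiple of e_n^(p-1) c_n ([top_expg_p]).
    - If g in N_n, n = 1 mod p, commutes with f, comparing coefficients in
      f g = g f shows that (e_n, c_n) of g is proportional to the direction of
      f ([direction_of_commuting]). By induction the two facts together say that
      for f good, f^(p^m) has depth exactly z_m - 1, and its two leading
      coefficients there still remember the direction of f ([expg_break]).
    - The commutator of elements of depths m and n not congruent mod p has depth
      m + n, hence two elements whose directions are independent generate every
      N / N_k ([independent_generate]).

    If k = z_m with m >= 1, a generating pair x, y has linearly independent
    directions, so that at most two of the lines spanned by x, y, xy are coordinate axes. One of
    the three is good and its power by p^m generates the subgroup
    N_(k-1) / N_k of order p. That subgroup is contained in every Sigma(x, y),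
    and there is no Beauville structure. For k = 2 = z_0 the group has order p and
    every nontrivial element serves.

    If z_m < k < z_(m+1), the subgroup of order p of a cyclic group generated by
    a good element f is generated by f^(p^m), and its coefficients at depths
    z_m - 1 and z_m survive in N / N_k. A cyclic group, generated by h say, that
    meets it nontrivially contains an element with these coefficients and
    commuting with h, so h is proportional to f in direction
    ([cyclic_meet_direction]). It is therefore enough to choose
    two generating pairs whose six directions are pairwise independent, with all
    of the second triple good: (1,0), (0,1), (1,1) and (1,2), (1,-1), (2,1). *)

(** * Coefficients of power series *)

Section Coefficients.
Local Open Scope ring_scope.
Variable R : comNzRingType.
Implicit Types a b : fps R.
Notation T := (fpsX R).

Lemma fps_vanish_le k l a : (l <= k)%N -> fps_vanish k a -> fps_vanish l a.
Proof. by move=> le_lk ak i lt_il; apply/ak/(leq_trans lt_il). Qed.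

Lemma fps_vanishS k a : fps_vanish k a -> fps_coef a k = 0 -> fps_vanish k.+1 a.
Proof. by move=> ak a0 i; rewrite ltnS leq_eqVlt => /predU1P[->|/ak]. Qed.

Lemma fps_coefB a b n : fps_coef (a - b) n = fps_coef a n - fps_coef b n.
Proof. by []. Qed.

Lemma fps_vanishB k a b : fps_vanish k a -> fps_vanish k b -> fps_vanish k (a - b).
Proof. by move=> ak bk i lt_ik; rewrite fps_coefB ak ?bk ?subr0. Qed.

Lemma fps_vanishM i j a b :
  fps_vanish i a -> fps_vanish j b -> fps_vanish (i + j) (a * b).
Proof.
move=> /fps_vanishP[c ->] /fps_vanishP[d ->]; apply/fps_vanishP.
by exists (c * d); rewrite exprD mulrACA.
Qed.

Lemma fps_coefM_lead i j a b : fps_vanish i a -> fps_vanish j b ->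
  fps_coef (a * b) (i + j) = fps_coef a i * fps_coef b j.
Proof.
move=> /fps_vanishP[c ->] /fps_vanishP[d ->].
by rewrite mulrACA -exprD !fps_coefXnM !ltnn !subnn fps_coefM big_ord1.
Qed.

Lemma fps_coefXn i n : fps_coef (T ^+ i) n = (n == i)%:R.
Proof.
rewrite -[T ^+ i]mulr1 fps_coefXnM.
have -> m : fps_coef (1 : fps R) m = (m == 0)%:R by case: m.
case: ltngtP => [//|lt_in|->]; last by rewrite subnn.
by rewrite subn_eq0 leqNgt lt_in.
Qed.

Lemma fps_coefXnDM k a n : fps_coef (T ^+ k * a) (k + n) = fps_coef a n.
Proof. by rewrite fps_coefXnM ltnNge leq_addr addKn. Qed.

Lemma fps_vanishXn i : fps_vanish i (T ^+ i).
Proof. by move=> n lt_ni; rewrite fps_coefXn ltn_eqF. Qed.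

Lemma fps_coefMn a m n : fps_coef (a *+ m) n = fps_coef a n *+ m.
Proof. by elim: m => [|m IHm]; rewrite ?mulr0n // !mulrS fps_coefD IHm. Qed.

Lemma fps_constM x a n : fps_coef (fps_const x * a) n = x * fps_coef a n.
Proof.
rewrite fps_coefM big_ord_recl /= subn0 big1 ?addr0 // => i _.
by rewrite mul0r.
Qed.

Lemma fps_vanish_head j a : fps_vanish j a ->
  exists b, a = fps_const (fps_coef a j) * T ^+ j +
                fps_const (fps_coef a j.+1) * T ^+ j.+1 + b /\ fps_vanish j.+2 b.
Proof.
move=> aj; set c := _ + _; exists (a - c); split; first by rewrite addrC subrK.
move=> i; rewrite fps_coefB fps_coefD !fps_constM !fps_coefXn !ltnS.
case: ltngtP => [lt_ij1|//|->] _; last first.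
  by rewrite gtn_eqF // mulr0 mulr1 add0r subrr.
have [->|ne_ij] := eqVneq i j; first by rewrite mulr0 mulr1 addr0 subrr.
by rewrite !mulr0 addr0 subr0 aj // ltn_neqAle ne_ij -ltnS.
Qed.

End Coefficients.

(** * Leading coefficients and the operator g - 1 *)

Section Depth.
Local Open Scope ring_scope.
Variable p : nat.
Notation F := 'F_p.
Notation T := (fpsX F).
Notation N := (nottingham p).
Implicit Types f g h : N.

(** The leading coefficient of g(t) - t for g in N_n. *)
Definition top g n : F := fps_coef (g T) n.+1.
Definition sq_top g n : F := if n == 1 then top g n ^+ 2 else 0.
(** The next coefficient; for n = 1 composition adds the cross term 2ab, which
    subtracting the square of the leading coefficient removes. *)
Definition subtop g n : F := fps_coef (g T) n.+2 - sq_top g n.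

Definition delta g (a : fps F) := g a - a.

Lemma deltaD g : {morph delta g : a b / a + b}.
Proof. by move=> a b; rewrite /delta rmorphD /=; ring. Qed.

Lemma deltaZ g x a : delta g (fps_const x * a) = fps_const x * delta g a.
Proof. by rewrite /delta rmorphM /= morph_const mulrBr. Qed.

Lemma deltaM g a b :
  delta g (a * b) = delta g a * b + a * delta g b + delta g a * delta g b.
Proof. by rewrite /delta rmorphM /=; ring. Qed.

Lemma deltaT_coef g n : fps_coef (delta g T) n.+2 = fps_coef (g T) n.+2.
Proof. by rewrite fps_coefB subr0. Qed.

Lemma nott_sub1_full g : g \in nott_sub 1.
Proof. by apply/nott_subP/normalisedP; case: (nott_autP g). Qed.

(** In g(t)^j = t^j (1 + w)^j the term j w contributes the coefficients of w,
    and w^2 reaches the second one exactly when n = 1: this is the role of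
    [sq_top], with 'C(j, 2) shifted to 'C(j.+1, 2) by its occurrence in
    [subtop]. *)
Lemma deltaXn g n j : (0 < n)%N -> g \in nott_sub n ->
  [/\ fps_vanish (j + n) (delta g (T ^+ j)),
      fps_coef (delta g (T ^+ j)) (j + n) = j%:R * top g n &
      fps_coef (delta g (T ^+ j)) (j + n).+1 =
        j%:R * subtop g n + 'C(j.+1, 2)%:R * sq_top g n].
Proof.
case: n => // n _ /nott_subP gn; elim: j => [|j [IHv IH0 IH1]].
  by rewrite expr0 /delta rmorph1 subrr !mul0r addr0; split => // i _.
rewrite exprS deltaM mulrC.
have v1 := fps_vanishM (@fps_vanishXn _ j) gn.
have v3 := fps_vanishM gn IHv.
rewrite !addSn !addnS in v1 IHv IH0 IH1 v3 *; split.
- apply: fps_vanishD; first apply: fps_vanishD; first exact: v1.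
    by move=> [|i]; rewrite fps_coefXM // => /IHv.
  by apply: fps_vanish_le v3; lia.
- rewrite 2!fps_coefD fps_coefXM IH0 v3; last by lia.
  have -> : fps_coef (T ^+ j * delta g T) (j + n).+2 = top g n.+1.
    by rewrite -!addnS fps_coefXnDM deltaT_coef.
  by ring.
rewrite 2!fps_coefD fps_coefXM IH1.
have -> : fps_coef (T ^+ j * delta g T) (j + n).+3 = subtop g n.+1 + sq_top g n.+1.
  by rewrite -!addnS fps_coefXnDM deltaT_coef /subtop subrK.
have -> : fps_coef (delta g T * delta g (T ^+ j)) (j + n).+3 = j%:R * sq_top g n.+1.
  rewrite /sq_top; case: n gn IHv IH0 v3 {v1 IH1} => [|n] gn IHv IH0 v3.
    rewrite addn0 in IHv IH0 *.
    have := fps_coefM_lead gn IHv; rewrite add2n IH0 deltaT_coef => ->.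
    by rewrite eqxx /top; ring.
  by rewrite v3 ?mulr0 //; lia.
rewrite (binS j.+1) bin1 natrD; ring.
Qed.

Lemma delta_vanish g n j a : (0 < n)%N -> g \in nott_sub n ->
  fps_vanish j a -> fps_vanish (j + n) (delta g a).
Proof.
move=> n_gt0 gn /fps_vanishP[b ->]; rewrite deltaM.
have [v _ _] := deltaXn j n_gt0 gn.
have vb : fps_vanish n (delta g b).
  by apply: fps_vanish_le (nott_sub_trivial b gn).
apply: fps_vanishD; first apply: fps_vanishD.
- by rewrite mulrC; apply: fps_vanishMl.
- by apply: fps_vanishM vb; apply: fps_vanishXn.
- by rewrite mulrC; apply: fps_vanishMl.
Qed.

(** The computation on which all the others rest: delta acts on the two leading
    coefficients of a series of order j, and only j mod p matters. *)
Lemma delta_coef g n j a : (0 < n)%N -> g \in nott_sub n -> fps_vanish j a ->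
  fps_coef (delta g a) (j + n) = j%:R * top g n * fps_coef a j /\
  fps_coef (delta g a) (j + n).+1 =
    fps_coef a j * (j%:R * subtop g n + 'C(j.+1, 2)%:R * sq_top g n) +
    j.+1%:R * top g n * fps_coef a j.+1.
Proof.
move=> n_gt0 gn aj; have [b [def_a bj]] := fps_vanish_head aj.
have [_ h0 h1] := deltaXn j n_gt0 gn.
have [k1 k0 _] := deltaXn j.+1 n_gt0 gn.
have vb := delta_vanish n_gt0 gn bj.
rewrite [in LHS]def_a [in X in _ /\ X = _]def_a !deltaD !deltaZ.
split; rewrite 2!fps_coefD !fps_constM ?h0 ?h1 vb ?ltnS ?leqnn ?leqnSn //.
  by rewrite k1 ?addSn //; ring.
by rewrite -addSn k0; ring.
Qed.

Lemma mulg_delta f g : (f * g)%g T - T = delta f T + delta g T + delta f (delta g T).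
Proof. by rewrite nott_mulE /delta rmorphB /=; ring. Qed.

Lemma top_delta g n : (0 < n)%N -> top g n = fps_coef (delta g T) n.+1.
Proof. by case: n => // n _; rewrite deltaT_coef. Qed.

Lemma subtop_delta g n : subtop g n = fps_coef (delta g T) n.+2 - sq_top g n.
Proof. by rewrite deltaT_coef. Qed.

Lemma nott_subM n f g :
  f \in nott_sub n -> g \in nott_sub n -> (f * g)%g \in nott_sub n.
Proof. exact/(group_closedM (@nott_sub_closed p n)). Qed.

Lemma nott_subV n f : f \in nott_sub n -> (f^-1)%g \in nott_sub n.
Proof. exact/(group_closedV (@nott_sub_closed p n)). Qed.

Lemma nott_sub_one n : (1%g : N) \in nott_sub n.
Proof. by case: (@nott_sub_closed p n). Qed.

Lemma nott_subX n f e : f \in nott_sub n -> (f ^+ e)%g \in nott_sub n.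
Proof.
by move=> fn; elim: e => [|e IHe]; [exact: nott_sub_one | rewrite expgS nott_subM].
Qed.

Lemma nott_sub_le m n f : (m <= n)%N -> f \in nott_sub n -> f \in nott_sub m.
Proof. by move=> le_mn /nott_subP fn; apply/nott_subP; apply: fps_vanish_le fn. Qed.

Lemma nott_subS n f : (0 < n)%N ->
  f \in nott_sub n -> top f n = 0 -> f \in nott_sub n.+1.
Proof.
move=> n_gt0 /nott_subP fn; rewrite top_delta // => f0.
by apply/nott_subP; apply: fps_vanishS.
Qed.

Lemma top_eq0 n f : (0 < n)%N -> f \in nott_sub n.+1 -> top f n = 0.
Proof. by move=> n_gt0 /nott_subP fn; rewrite top_delta //; apply: fn. Qed.

Lemma delta2_coef n f g : (0 < n)%N -> f \in nott_sub n -> g \in nott_sub n ->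
  fps_coef (delta f (delta g T)) n.+1 = 0 /\
  fps_coef (delta f (delta g T)) n.+2 = if n == 1 then 2%:R * top f n * top g n else 0.
Proof.
move=> n_gt0 fn gn; have vg := elimT (nott_subP _ _) gn.
have v := delta_vanish n_gt0 fn vg.
have [h _] := delta_coef n_gt0 fn vg.
split; first by rewrite v //; lia.
by case: eqP => [e|ne]; [subst n; rewrite -top_delta // in h | rewrite v //; lia].
Qed.

Lemma topM n f g : (0 < n)%N -> f \in nott_sub n -> g \in nott_sub n ->
  top (f * g)%g n = top f n + top g n.
Proof.
move=> n_gt0 fn gn; have [h _] := delta2_coef n_gt0 fn gn.
by rewrite !top_delta // {1}/delta mulg_delta 2!fps_coefD h addr0.
Qed.

Lemma subtopM n f g : (0 < n)%N -> f \in nott_sub n -> g \in nott_sub n ->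
  subtop (f * g)%g n = subtop f n + subtop g n.
Proof.
move=> n_gt0 fn gn; have [_ h] := delta2_coef n_gt0 fn gn.
rewrite !subtop_delta {1}/delta mulg_delta 2!fps_coefD h /sq_top topM //.
by case: eqP => _; ring.
Qed.

Lemma top1 n : (0 < n)%N -> top (1%g : N) n = 0.
Proof. by move=> n_gt0; rewrite top_delta // /delta nott_oneE subrr. Qed.

Lemma topX n f e : (0 < n)%N -> f \in nott_sub n -> top (f ^+ e)%g n = e%:R * top f n.
Proof.
move=> n_gt0 fn; elim: e => [|e IHe]; first by rewrite top1 // mul0r.
by rewrite expgS topM ?nott_subX // IHe -natr1 mulrDl mul1r addrC.
Qed.

Lemma subtopX n f e : (0 < n)%N -> f \in nott_sub n -> subtop (f ^+ e)%g n = e%:R * subtop f n.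
Proof.
move=> n_gt0 fn; elim: e => [|e IHe].
  by rewrite subtop_delta /delta nott_oneE subrr /sq_top top1 // expr0n if_same subrr mul0r.
by rewrite expgS subtopM ?nott_subX // IHe -natr1 mulrDl mul1r addrC.
Qed.

Lemma topV n f : (0 < n)%N -> f \in nott_sub n -> top f^-1%g n = - top f n.
Proof.
move=> n_gt0 fn; apply/eqP; rewrite -addr_eq0 addrC -topM ?nott_subV //.
by rewrite mulgV top1.
Qed.

Lemma subtopV n f : (0 < n)%N -> f \in nott_sub n -> subtop f^-1%g n = - subtop f n.
Proof.
move=> n_gt0 fn; apply/eqP; rewrite -addr_eq0 addrC -subtopM ?nott_subV //.
by rewrite mulgV -(expg0 1%g) subtopX ?nott_sub_one // mul0r.
Qed.

(** The commutator h satisfies (g f) h = f g, so g f maps h(t) - t to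
    f g (t) - g f (t), the commutator of f - 1 and g - 1 applied to t, and g f
    preserves leading terms. *)
Lemma comm_depth m n f g : (0 < m)%N -> (0 < n)%N ->
  f \in nott_sub m -> g \in nott_sub n ->
  let h := ((g * f)^-1 * (f * g))%g in
  h \in nott_sub (m + n) /\ top h (m + n) = (n%:R - m%:R) * top f m * top g n.
Proof.
move=> m_gt0 n_gt0 fm gn h.
have vf := elimT (nott_subP _ _) fm; have vg := elimT (nott_subP _ _) gn.
have E : delta (g * f)%g (delta h T) + delta h T =
    delta f (delta g T) - delta g (delta f T).
  have hE : (g * f)%g (h T) = f (g T) by rewrite -nott_mulE mulVKg.
  by rewrite {1}/delta subrK /delta !nottB hE nott_mulE; ring.
have v1 := delta_vanish m_gt0 fm vg; have v2 := delta_vanish n_gt0 gn vf.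
have [c1 _] := delta_coef m_gt0 fm vg; have [c2 _] := delta_coef n_gt0 gn vf.
have hD : delta h T = (g * f)^-1%g (delta f (delta g T) - delta g (delta f T)).
  by rewrite -E {1}/delta subrK -nott_mulE mulVg.
have hN : fps_vanish (m + n).+1 (delta h T).
  rewrite hD; apply: nott_vanish; apply: fps_vanishB; first by rewrite addnC.
  exact: v2.
split; first exact/nott_subP.
rewrite top_delta ?addn_gt0 ?m_gt0 //.
have := congr1 (fun a => fps_coef a (m + n).+1) E.
rewrite fps_coefD fps_coefB.
have [+ _] := delta_coef (a := delta h T) (ltn0Sn 0) (nott_sub1_full (g * f)%g) hN.
have z : fps_coef (delta (g * f)%g (delta h T)) (m + n).+1 = 0.
  by apply: (delta_vanish (ltn0Sn 0) (nott_sub1_full (g * f)%g) hN); rewrite addn1.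
rewrite z add0r => _ ->; rewrite addSn in c2; rewrite addSn addnC in c1.
rewrite c1 c2 -!top_delta // -!natr1; ring.
Qed.

Lemma nott_expS g m a : (g ^+ m.+1)%g a = g ((g ^+ m)%g a).
Proof. by rewrite expgS. Qed.

Lemma expg_delta g m a :
  (g ^+ m)%g a = \sum_(i < m.+1) iter i (delta g) a *+ 'C(m, i).
Proof.
elim: m => [|m IHm]; first by rewrite big_ord1 expg0 nott_oneE.
rewrite nott_expS IHm rmorph_sum /=.
under eq_bigr => i _.
  rewrite rmorphMn /= -[g _](subrK (iter i (delta g) a)) -/(delta g _) addrC mulrnDl.
over.
rewrite big_split /= big_ord_recl bin0 [RHS]big_ord_recl bin0 -addrA; congr (_ + _).
under [RHS]eq_bigr => i _ do rewrite /= binS mulrnDr.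
rewrite big_split /=; congr (_ + _).
by rewrite [RHS]big_ord_recr /= bin_small // mulr0n addr0.
Qed.

(** * Powers and commuting elements *)

Hypothesis p_prime : prime p.

Lemma natrF_eq0 n : (n%:R == 0 :> F) = (p %| n)%N.
Proof. by rewrite -(dvdn_pcharf (pchar_Fp p_prime)). Qed.

(** Frobenius for the operator g = 1 + delta. *)
Lemma expg_p_delta g a : (g ^+ p)%g a - a = iter p (delta g) a.
Proof.
suff h m : m = p -> (g ^+ m)%g a - a = iter m (delta g) a by apply: h.
case: m => [p0|m def_p]; first by have := prime_gt0 p_prime; rewrite -{1}p0.
rewrite expg_delta big_ord_recl big_ord_recr /= bin0 binn !mulr1n addrAC subrr add0r.
rewrite big1 ?add0r // => i _; apply: fpsP => n.
rewrite fps_coefMn -mulr_natr; apply/eqP; rewrite mulf_eq0 natrF_eq0.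
apply/orP; right; rewrite def_p prime_dvd_bin // -def_p.
by rewrite /bump /= add1n ltnS ltn_ord.
Qed.

Hypothesis p_gt2 : (2 < p)%N.

Lemma natr_fact_neq0 n : (n < p)%N -> n`!%:R != 0 :> F.
Proof.
elim: n => [|n IHn] lt_np; first by rewrite oner_eq0.
by rewrite factS natrM mulf_neq0 ?IHn 1?ltnW // natrF_eq0 gtnNdvd.
Qed.

Lemma bin2_eq0 j : (j%:R == 0 :> F) || (j.+1%:R == 0 :> F) -> 'C(j.+1, 2)%:R = 0 :> F.
Proof.
rewrite !natrF_eq0 orbC -Euclid_dvdM //.
have -> : (j.+1 * j = 2 * 'C(j.+1, 2))%N by rewrite -mul_bin_diag bin1.
rewrite Euclid_dvdM // gtnNdvd //= => dv; apply/eqP; by rewrite natrF_eq0.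
Qed.

Lemma iter_delta_lead g n i : (0 < n)%N -> n%:R = 1 :> F -> g \in nott_sub n ->
  fps_vanish (1 + i * n) (iter i (delta g) T) /\
  fps_coef (iter i (delta g) T) (1 + i * n) = (i`!)%:R * top g n ^+ i.
Proof.
move=> n_gt0 n1 gn; elim: i => [|i [IHv IHc]].
  by rewrite mul0n addn0 expr0; split=> [[]|] //=; rewrite mul1r.
have -> : (1 + i.+1 * n = (1 + i * n) + n)%N by rewrite mulSn; lia.
rewrite iterS; split; first exact: delta_vanish.
have [-> _] := delta_coef n_gt0 gn IHv.
by rewrite IHc natrD natrM n1 factS natrM exprS -natr1; ring.
Qed.

(** As n = 1 mod p, the orders of the iterates delta^i t run through the
    residues 1, 2, ..., p. The first leading coefficients are multiplied by
    1, 2, ..., p - 2; at order -1 the carry of the second coefficient is killed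
    by the factor j + 1 = 0, so only the contribution of [subtop] survives, and
    at order 0 the leading term itself dies. Both binomials met on the way
    vanish, since p is odd. *)
Lemma top_expg_p g n : (0 < n)%N -> n%:R = 1 :> F -> g \in nott_sub n ->
  (g ^+ p)%g \in nott_sub (p * n).+1 /\
  top (g ^+ p)%g (p * n).+1 = - ((p.-2)`!)%:R * top g n ^+ p.-1 * subtop g n.
Proof.
move=> n_gt0 n1 gn.
have [q def_p] : exists q, p = q.+2 by exists p.-2; rewrite -subn2 -addn2 subnK // ltnW.
have [-> ->] : p.-1 = q.+1 /\ p.-2 = q by rewrite def_p.
have q2 : q.+2%:R = 0 :> F by apply/eqP; rewrite natrF_eq0 -def_p.
have [v0 c0] := iter_delta_lead q n_gt0 n1 gn.
set j := (1 + q * n)%N in v0 c0.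
have j1 : j.+1%:R = 0 :> F by rewrite -q2 /j add1n -!natr1 natrM n1 mulr1.
have jn : (j + n)%:R = 0 :> F by rewrite natrD n1 natr1.
have v1 := delta_vanish n_gt0 gn v0; have [d1 e1] := delta_coef n_gt0 gn v0.
have v2 := delta_vanish n_gt0 gn v1; have [d2 e2] := delta_coef n_gt0 gn v1.
have Dp : delta (g ^+ p)%g T = delta g (delta g (iter q (delta g) T)).
  by rewrite /delta expg_p_delta -[RHS]/(iter q.+2 (delta g) T) -def_p.
have jnn : (j + n + n = (p * n).+1)%N by rewrite /j [in RHS]def_p; lia.
rewrite jnn jn in v2 d2 e2.
rewrite !mul0r in d2.
have v3 : fps_vanish (p * n).+2 (delta (g ^+ p)%g T).
  by rewrite Dp; apply: fps_vanishS.
split; first exact/nott_subP.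
rewrite top_delta // Dp e2 -[(j + n).+1%:R]natr1 jn.
rewrite d1 e1 (bin2_eq0 (j := j)) ?j1 ?eqxx ?orbT // (bin2_eq0 (j := j + n)) ?jn ?eqxx //.
rewrite c0.
have -> : j%:R = -1 :> F by apply/eqP; rewrite -addr_eq0 natr1 j1.
by rewrite exprS; ring.
Qed.

(** Equate the second coefficients of delta_f (delta_g t) and
    delta_g (delta_f t). The first ones agree automatically for n = 1 mod p. *)
Lemma direction_of_commuting f g n : (0 < n)%N -> n%:R = 1 :> F -> g \in nott_sub n ->
  commute f g -> top f 1 * subtop g n = top g n * subtop f 1.
Proof.
move=> n_gt0 n1 gn fg.
have vf := elimT (nott_subP _ _) (nott_sub1_full f); have vg := elimT (nott_subP _ _) gn.
have E : delta f (delta g T) = delta g (delta f T).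
  by rewrite /delta !nottB -!nott_mulE fg; ring.
have [_ c1] := delta_coef (ltn0Sn 0) (nott_sub1_full f) vg.
have [_ c2] := delta_coef n_gt0 gn vf.
move: c1; rewrite E addn1 -[n.+2]add2n c2 -/(delta g T) -/(delta f T).
have -> : 'C(n.+2, 2)%:R = 3%:R :> F.
  have two0 : 2%:R != 0 :> F by rewrite natrF_eq0 gtnNdvd.
  apply: (mulfI two0); rewrite -natrM -mul_bin_diag bin1 natrM.
  by rewrite -[n.+2%:R]natr1 -[n.+1%:R]natr1 n1; ring.
rewrite -[n.+2%:R]natr1 -[n.+1%:R]natr1 n1.
rewrite !deltaT_coef.
have -> : fps_coef (g T) n.+2 = subtop g n + sq_top g n by rewrite /subtop subrK.
have -> : fps_coef (f T) 3 = subtop f 1 + sq_top f 1 by rewrite /subtop subrK.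
rewrite (_ : 'C(3, 2) = 3%N) // -top_delta // -/(top f 1).
have -> : sq_top f 1 = top f 1 ^+ 2 by [].
move/eqP; rewrite -subr_eq0 => h; apply/esym/eqP; rewrite -subr_eq0.
by move: h; congr (_ == 0); ring.
Qed.

(** * The quotients N / N_k *)

Definition ncoset k (f : N) : nott_quo p k := (\pi_(quot (nott_nsub p k)) f)%qT.

Lemma ncosetP k f g : reflect (ncoset k f = ncoset k g) ((f^-1 * g)%g \in nott_sub k).
Proof. exact: (@Defs.quotP _ (nott_nsub p k)). Qed.

Lemma ncoset_ex k (u : nott_quo p k) : exists f, u = ncoset k f.
Proof. exact: (@quot_ex _ (nott_nsub p k)). Qed.

Lemma ncoset1 k : ncoset k 1%g = 1%g.
Proof. by []. Qed.

Lemma ncosetM k : {morph ncoset k : f g / (f * g)%g}.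
Proof. by move=> f g; rewrite -[RHS]/(quot_mul _ _) quot_mulE. Qed.

Lemma ncosetV k : {morph ncoset k : f / f^-1%g}.
Proof. by move=> f; rewrite -[RHS]/(quot_inv _) quot_invE. Qed.

Lemma ncosetX k e : {morph ncoset k : f / (f ^+ e)%g}.
Proof.
by move=> f; elim: e => [|e IHe]; rewrite ?expg0 ?ncoset1 // !expgS ncosetM IHe.
Qed.

Lemma ncosetJ k : {morph ncoset k : f g / (f ^ g)%g}.
Proof. by move=> f g; rewrite /conjg !ncosetM ncosetV. Qed.

Lemma ncoset_eq1 k f : (ncoset k f == 1%g) = (f \in nott_sub k).
Proof.
rewrite -ncoset1 eq_sym; apply/eqP/idP => [/ncosetP|fk]; first by rewrite invg1 mul1g.
by apply/ncosetP; rewrite invg1 mul1g.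
Qed.

Lemma ncoset_coef k f g i : ncoset k f = ncoset k g -> (i <= k)%N ->
  fps_coef (f T) i = fps_coef (g T) i.
Proof.
move=> /ncosetP; rewrite nott_sub_congr => /forallP fg le_ik.
exact: (eqP (fg (Ordinal (le_ik : (i < k.+1)%N)))).
Qed.

(** * Powers of elements in good direction *)

(** The lower ramification breaks 1, p + 1, p^2 + p + 1, ... of a minimally
    ramified series. *)
Fixpoint break m := if m is m'.+1 then (p * break m').+1 else 1%N.

Lemma znum_break m : znum p m = (break m).+1.
Proof.
suff -> : (break m = (\sum_(1 <= i < m.+1) p ^ i).+1)%N by rewrite /znum addn2.
elim: m => [|m IHm] /=; first by rewrite big_geq.
rewrite IHm [in RHS]big_nat_recl // expn1 mulnS big_distrr /=; congr (_ + _).+1.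
by apply: eq_bigr => i _; rewrite expnS.
Qed.

Lemma break_gt0 m : (0 < break m)%N.
Proof. by case: m. Qed.

Lemma break_natr m : (break m)%:R = 1 :> F.
Proof.
case: m => // m; rewrite /= -natr1 natrM.
by have /eqP -> : p%:R == 0 :> F; [rewrite natrF_eq0 | rewrite mul0r add0r].
Qed.

Lemma break_lt m : (break m < break m.+1)%N.
Proof. by rewrite /= ltnS leq_pmull // ltnW // ltnW. Qed.

(** The power f^(p^m) commutes with f, so its [subtop] is nonzero as soon as its
    leading coefficient is, and [top_expg_p] applies again. *)
Lemma expg_break f m : top f 1 != 0 -> subtop f 1 != 0 ->
  (f ^+ (p ^ m))%g \in nott_sub (break m) /\ top (f ^+ (p ^ m))%g (break m) != 0.
Proof.
move=> a0 c0; elim: m => [|m [IHn IHt]]; first by rewrite expg1 nott_sub1_full.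
have rel := direction_of_commuting (break_gt0 m) (break_natr m) IHn
  (commuteX _ (commute_refl f)).
have [pn pt] := top_expg_p (break_gt0 m) (break_natr m) IHn.
rewrite expnSr expgM /= pt; split=> //.
have fact0 : (p.-2)`!%:R != 0 :> F.
  by apply: natr_fact_neq0; rewrite -subn2 ltn_subrL /= prime_gt0.
rewrite !mulf_neq0 ?oppr_eq0 ?expf_neq0 //.
by apply: contraNneq (mulf_neq0 IHt c0) => cg; rewrite -rel cg mulr0.
Qed.

(** A nontrivial common element of two cyclic groups can be raised to a power of
    p so that it becomes a generator of the subgroup of order p of the first one;
    f1 and f2 are then both proportional to its leading coefficients. *)
Lemma cyclic_meet_direction f1 f2 m k i j :
  top f1 1 != 0 -> subtop f1 1 != 0 ->
  (znum p m < k)%N -> (k < znum p m.+1)%N ->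
  ncoset k (f1 ^+ i)%g != 1%g -> ncoset k (f1 ^+ i)%g = ncoset k (f2 ^+ j)%g ->
  top f1 1 * subtop f2 1 = top f2 1 * subtop f1 1.
Proof.
rewrite ncoset_eq1 !znum_break => a0 c0 lt_mk lt_km ik ijk.
have i_gt0 : (0 < i)%N by case: i ik {ijk} => //; rewrite expg0 nott_sub_one.
have [i' cop_i' def_i] := pfactor_coprime p_prime i_gt0.
set s := logn p i in def_i.
have le_sm : (s <= m)%N.
  rewrite leqNgt; apply: contraNN ik => lt_ms.
  have [h _] := expg_break m.+1 a0 c0.
  rewrite def_i mulnC -(subnK lt_ms) expnD mulnAC mulnC expgM nott_subX //.
  by apply: nott_sub_le h; rewrite -ltnS.
have [gn gt] := expg_break m a0 c0.
set n := break m in gn gt lt_mk.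
have n_gt0 : (0 < n)%N by apply: break_gt0.
have n1 : n%:R = 1 :> F by apply: break_natr.
(* This power makes i * q the product of p ^ m by a number prime to p. *)
set q := (p ^ (m - s))%N.
set u1 := ((f1 ^+ i) ^+ q)%g; set u2 := ((f2 ^+ j) ^+ q)%g.
have def_u1 : u1 = ((f1 ^+ (p ^ m)) ^+ i')%g.
  by rewrite /u1 /q -!expgM def_i -mulnA -expnD subnKC // mulnC.
have u1n : u1 \in nott_sub n by rewrite def_u1 nott_subX.
have u1t : top u1 n != 0.
  rewrite def_u1 topX // mulf_neq0 // natrF_eq0 -prime_coprime //.
have u12 : ncoset k u1 = ncoset k u2 by rewrite /u1 /u2 !(ncosetX k q) ijk.
have le_nk : (n <= k)%N by apply: ltnW; apply: ltnW.
have u2n : u2 \in nott_sub n.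
  rewrite -(mulKVg u1 u2) nott_subM //.
  by apply: (nott_sub_le le_nk); apply/ncosetP.
have eq_t : top u2 n = top u1 n by rewrite /top -(ncoset_coef u12 (ltnW lt_mk)).
have eq_c : subtop u2 n = subtop u1 n.
  by rewrite /subtop /sq_top eq_t -(ncoset_coef u12 lt_mk).
have r1 := direction_of_commuting n_gt0 n1 u1n (commuteX _ (commuteX _ (commute_refl f1))).
have := direction_of_commuting n_gt0 n1 u2n (commuteX _ (commuteX _ (commute_refl f2))).
rewrite eq_t eq_c => r2.
apply: (mulfI u1t); rewrite mulrCA -r2 [RHS]mulrCA -r1; ring.
Qed.

(** * Generation *)

(** Depth n is reached as a commutator of depths n - 1 and 1, unless they are
    congruent mod p; then n - 2 = 0 mod p and depths n - 2 and 2 work. *)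
Lemma generated_depth k (H : {group nott_quo p k}) f1 f2 :
  ncoset k f1 \in H -> ncoset k f2 \in H ->
  top f1 1 * subtop f2 1 != top f2 1 * subtop f1 1 ->
  forall n, (0 < n)%N -> exists h, [/\ ncoset k h \in H, h \in nott_sub n & top h n != 0].
Proof.
move=> Hf1 Hf2 det0; elim/ltn_ind=> -[//|[|[|n]]] IHn _.
- have [a1|a1] := eqVneq (top f1 1) 0; last by exists f1; split=> //; apply: nott_sub1_full.
  exists f2; split=> //; first exact: nott_sub1_full.
  by apply: contraNneq det0 => a2; rewrite a1 a2 !mul0r.
(* Cancel the leading coefficients; the determinant is what remains. *)
- pose h := (f1 ^+ val (top f2 1) * (f2 ^+ val (top f1 1))^-1)%g.
  have N1 f : f \in nott_sub 1 := nott_sub1_full f.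
  have h2 : h \in nott_sub 2.
    apply: nott_subS => //.
    by rewrite topM // topV // !topX // !natr_Zp mulrC subrr.
  exists h; split=> //; first by rewrite ncosetM ncosetV !ncosetX groupM ?groupV ?groupX.
  have -> : top h 2 = subtop h 1 by rewrite /subtop /sq_top /= (top_eq0 _ h2) // expr0n subr0.
  rewrite subtopM // subtopV // !subtopX // !natr_Zp.
  by rewrite subr_eq0 eq_sym.
have comm i j : (0 < i)%N -> (0 < j)%N -> (i < n.+3)%N -> (j < n.+3)%N ->
    (i + j = n.+3)%N -> j%:R - i%:R != 0 :> F ->
    exists h, [/\ ncoset k h \in H, h \in nott_sub n.+3 & top h n.+3 != 0].
  move=> i_gt0 j_gt0 lt_i lt_j <- ne_ij.
  have [f [Hf fi tf]] := IHn i lt_i i_gt0; have [g [Hg gj tg]] := IHn j lt_j j_gt0.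
  have [hn ht] := comm_depth i_gt0 j_gt0 fi gj.
  exists ((g * f)^-1 * (f * g))%g; split=> //; last by rewrite ht !mulf_neq0.
  by rewrite !(ncosetM, ncosetV) !(groupM, groupV).
have [n1|n1] := eqVneq (n.+2%:R : F) 1; last first.
  by apply: (comm n.+2 1%N); rewrite ?addn1 // subr_eq0 eq_sym.
case: n n1 IHn comm => [|n] n1 IHn comm.
  by move/eqP: n1; rewrite -subr_eq0 -natr1 addrK oner_eq0.
apply: (comm n.+2 2%N); rewrite ?addn2 //.
move/eqP: n1; rewrite -natr1 -subr_eq0 addrK => /eqP ->.
by rewrite subr0 natrF_eq0 gtnNdvd.
Qed.

Lemma independent_generate k (H : {group nott_quo p k}) f1 f2 :
  ncoset k f1 \in H -> ncoset k f2 \in H ->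
  top f1 1 * subtop f2 1 != top f2 1 * subtop f1 1 -> H = [set: nott_quo p k] :> {set _}.
Proof.
move=> Hf1 Hf2 det0; apply/eqP; rewrite eqEsubset subsetT /=; apply/subsetP => u _.
have [f ->] := ncoset_ex u.
suff [h Hh hf] : exists2 h, ncoset k h \in H & (h^-1 * f)%g \in nott_sub k.
  by rewrite -(elimT (ncosetP _ _ _) hf).
suff gen n : exists2 h, ncoset k h \in H & (h^-1 * f)%g \in nott_sub n.+1.
  by have [h Hh hf] := gen k; exists h => //; apply: nott_sub_le hf.
elim: n => [|n [h Hh hf]]; first exists 1%g.
- by rewrite ncoset1 group1.
- exact: nott_sub1_full.
have [g [Hg gn gt]] := generated_depth Hf1 Hf2 det0 (ltn0Sn n).
pose e := val (top (h^-1 * f)%g n.+1 / top g n.+1).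
exists (h * g ^+ e)%g; first by rewrite ncosetM ncosetX groupM ?groupX.
have v := nott_subV (nott_subX e gn).
rewrite invgM -mulgA; apply: nott_subS; [by [] | exact: nott_subM |].
by rewrite topM // topV ?nott_subX // topX // natr_Zp divfK // addNr.
Qed.

(** Used with the coordinates on N / N_2 and N / N_3: two generators cannot
    both lie on one coordinate axis. *)
Lemma morph_generators k f1 f2 (phi : N -> F) :
  {morph phi : f g / (f * g)%g >-> f + g} ->
  (forall f, f \in nott_sub k -> phi f = 0) ->
  <<[set ncoset k f1; ncoset k f2]>>%g = [set: nott_quo p k] ->
  phi f1 = 0 -> phi f2 = 0 -> forall f, phi f = 0.
Proof.
move=> phiM phik gen phi1 phi2 f.
have phi_coset g h : ncoset k g = ncoset k h -> phi g = phi h.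
  by move=> /ncosetP/phik gh; rewrite -(mulKVg g h) phiM gh addr0.
pose K := [set u : nott_quo p k | phi (generic_quotient.repr u) == 0].
have inK g : (ncoset k g \in K) = (phi g == 0).
  rewrite inE (phi_coset _ g) // -[LHS]/(\pi_(quot (nott_nsub p k))%qT _).
  by rewrite generic_quotient.reprK.
have Kgroup : group_set K.
  apply/group_setP; split; first by rewrite -(ncoset1 k) inK phik ?nott_sub_one.
  move=> u v; have [g ->] := ncoset_ex u; have [h ->] := ncoset_ex v.
  by rewrite -ncosetM !inK phiM => /eqP -> /eqP ->; rewrite addr0.
have sGK : <<[set ncoset k f1; ncoset k f2]>>%g \subset (Group Kgroup).
  rewrite gen_subG; apply/subsetP => u; rewrite in_set2.
  by case/orP => /eqP ->; rewrite inK ?phi1 ?phi2.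
by apply/eqP; rewrite -inK; apply: (subsetP sGK); rewrite gen inE.
Qed.

End Depth.

(** * Substitution automorphisms *)

Section Substitution.
Local Open Scope ring_scope.
Variable p : nat.
Notation F := 'F_p.
Notation T := (fpsX F).

Lemma fps_const_zmod : GRing.zmod_morphism (@fps_const F).
Proof. by move=> x y; apply: fpsP => -[|n] //; rewrite fps_coefB /= subrr. Qed.

Lemma fps_const_monoid : GRing.monoid_morphism (@fps_const F).
Proof.
split=> // x y; apply: fpsP => n; rewrite fps_constM.
by case: n => [|n] /=; rewrite ?mulr0.
Qed.

HB.instance Definition _ :=
  GRing.isZmodMorphism.Build F (fps F) (@fps_const F) fps_const_zmod.
HB.instance Definition _ :=
  GRing.isMonoidMorphism.Build F (fps F) (@fps_const F) fps_const_monoid.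

Section Series.
Variable s : fps F.
Hypothesis s0 : fps_coef s 0 = 0.

Definition peval (P : {poly F}) : fps F := (map_poly (@fps_const F) P).[s].

Lemma pevalB P Q : peval (P - Q) = peval P - peval Q.
Proof. by rewrite /peval rmorphB hornerD hornerN. Qed.

Lemma pevalM P Q : peval (P * Q) = peval P * peval Q.
Proof. by rewrite /peval rmorphM hornerM. Qed.

Lemma pevalX : peval 'X = s.
Proof. by rewrite /peval map_polyX hornerX. Qed.

Lemma pevalC x : peval x%:P = fps_const x.
Proof. by rewrite /peval map_polyC hornerC. Qed.

Lemma peval_vanish k (P : {poly F}) :
  (forall i, (i < k)%N -> P`_i = 0) -> fps_vanish k (peval P).
Proof.
move=> P0; rewrite -[P](poly_take_drop k).
have -> : take_poly k P = 0.
  by apply/polyP => i; rewrite coef_take_poly coef0; case: ifP => // /P0.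
rewrite add0r pevalM; apply: fps_vanishMl.
rewrite /peval map_polyXn hornerXn.
have [|c ->] := (fps_vanishP 1 s).1; first by case.
by apply/fps_vanishP; exists (c ^+ k); rewrite expr1 exprMn.
Qed.

Lemma peval_congr k (P Q : {poly F}) : (forall i, (i < k)%N -> P`_i = Q`_i) ->
  forall i, (i < k)%N -> fps_coef (peval P) i = fps_coef (peval Q) i.
Proof.
move=> PQ i lt_ik; apply/eqP; rewrite -subr_eq0 -fps_coefB -pevalB.
by rewrite (peval_vanish (k := k)) // => j lt_jk; rewrite coefB PQ ?subrr.
Qed.

(** The series a(s(t)), computed from polynomial truncations of a: as s has no
    constant term, its coefficient of t^n depends on a mod t^(n+1) only. *)
Definition fps_subst (a : fps F) : fps F :=
  Fps (fun n => fps_coef (peval (fps_trunc n a)) n).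

Lemma fps_substE m n a : (n <= m)%N ->
  fps_coef (fps_subst a) n = fps_coef (peval (fps_trunc m a)) n.
Proof.
move=> le_nm; apply: (@peval_congr n.+1) => // i; rewrite ltnS => le_in.
by rewrite !coef_fps_trunc // (leq_trans le_in).
Qed.

Lemma fps_subst_zmod : GRing.zmod_morphism fps_subst.
Proof.
move=> a b; apply: fpsP => n; rewrite fps_coefB [RHS]/= -fps_coefB -pevalB [LHS]/=.
congr (fps_coef (peval _) n); apply/polyP => i; rewrite coefB !coef_poly.
by case: ifP => _ //; rewrite subrr.
Qed.

Lemma fps_subst_monoid : GRing.monoid_morphism fps_subst.
Proof.
split=> [|a b].
  apply: fpsP => n; rewrite -[RHS]/(fps_coef (fps_const (1 : F)) n) -pevalC /=.
  congr (fps_coef (peval _) n); apply/polyP => i; rewrite coef_poly coefC /=.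
  by case: i => [|i] //; rewrite if_same.
apply: fpsP => n; rewrite [RHS](@coef_fps_mul _ n) // coefM.
transitivity (fps_coef (peval (fps_trunc n a) * peval (fps_trunc n b)) n).
  rewrite -pevalM /=; apply: (@peval_congr n.+1) => // i; rewrite ltnS => le_in.
  by rewrite coef_fps_trunc // (coef_fps_mul _ _ le_in).
rewrite fps_coefM; apply: eq_bigr => i _.
have le_in : (i <= n)%N by rewrite -ltnS.
by rewrite !coef_fps_trunc ?leq_subr // (fps_substE _ le_in) (fps_substE _ (leq_subr _ _)).
Qed.

HB.instance Definition _ :=
  GRing.isZmodMorphism.Build (fps F) (fps F) fps_subst fps_subst_zmod.
HB.instance Definition _ :=
  GRing.isMonoidMorphism.Build (fps F) (fps F) fps_subst fps_subst_monoid.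

Lemma fps_substX : fps_subst T = s.
Proof.
apply: fpsP => n; rewrite (fps_substE _ (leqnSn n)) -[in RHS]pevalX.
congr (fps_coef (peval _) n); apply/polyP => i; rewrite coef_poly coefX.
by case: ltnP => //; case: i => [|[|i]].
Qed.

Hypothesis s1 : fps_coef s 1 = 1.

Lemma fps_subst_lead k a : fps_vanish k a ->
  fps_vanish k.+1 (a - fps_subst a).
Proof.
move=> /fps_vanishP[b ->]; rewrite rmorphM rmorphXn /= fps_substX.
have vs : fps_vanish 1 s by case.
have [vsk csk] : fps_vanish k (s ^+ k) /\ fps_coef (s ^+ k) k = 1.
  elim: k {b} => [|k [IHv IHc]]; first by split.
  rewrite exprS -[k.+1]add1n; split; first exact: fps_vanishM.
  by rewrite fps_coefM_lead // s1 IHc mulr1.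
have b0 : fps_coef (fps_subst b) 0 = fps_coef b 0.
  rewrite /= (_ : fps_trunc 0 b = (fps_coef b 0)%:P) ?pevalC //.
  by apply/polyP => -[|i]; rewrite coef_poly coefC.
have v0 (d : fps F) : fps_vanish 0 d by [].
have vT := @fps_vanishXn F k.
apply: fps_vanishS.
  have := fps_vanishB (fps_vanishM vT (v0 b)) (fps_vanishM vsk (v0 (fps_subst b))).
  by rewrite addn0.
have h := fps_coefM_lead vT (v0 b); have h' := fps_coefM_lead vsk (v0 (fps_subst b)).
by rewrite addn0 in h h'; rewrite fps_coefB h h' csk b0 fps_coefXn eqxx subrr.
Qed.

Lemma fps_subst_inj : injective fps_subst.
Proof.
move=> a b eq_ab; apply/subr0_eq.
have {eq_ab} : fps_subst (a - b) = 0 by rewrite rmorphB /= eq_ab subrr.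
move: (a - b) => {a b} a a0.
have v k : fps_vanish k a.
  by elim: k => [//|k /fps_subst_lead]; rewrite a0 subr0.
by apply: fpsP => n; apply: (v n.+1).
Qed.

(** Substitution of s is a topologically unipotent operator, as 1 - subst raises
    orders by [fps_subst_lead]; the Neumann series of (1 - subst)^i b converges
    coefficientwise to a preimage of b. *)
Lemma fps_subst_surj b : exists a, fps_subst a = b.
Proof.
pose r i := iter i (fun a => a - fps_subst a) b.
have rv i : fps_vanish i (r i) by elim: i => [//|i]; apply: fps_subst_lead.
pose a := Fps (fun n => \sum_(i < n.+1) fps_coef (r i) n).
exists a; apply: fpsP => n; apply/eqP; rewrite -subr_eq0 -fps_coefB.
pose S := \sum_(i < n.+1) r i.
have coefS i : fps_coef S i = \sum_(j < n.+1) fps_coef (r j) i.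
  rewrite /S; elim: n.+1 => [|m IHm]; first by rewrite !big_ord0.
  by rewrite !big_ord_recr fps_coefD IHm.
have aS : fps_vanish n.+1 (a - S).
  move=> i; rewrite ltnS => le_in; rewrite fps_coefB coefS /=.
  rewrite [X in _ - X](bigID (fun j : 'I__ => (j < i.+1)%N)) /=.
  rewrite (big_ord_widen n.+1 (fun j => fps_coef (r j) i)) //.
  by rewrite opprD addNKr ?big1 ?oppr0 ?addr0 ?subrr // => j; rewrite -leqNgt => /rv.
have fS : fps_subst S - b = - r n.+1.
  rewrite /S; elim: n.+1 => [|m IHm]; first by rewrite big_ord0 rmorph0 sub0r.
  by rewrite big_ord_recr rmorphD /= addrAC IHm opprB addrC.
rewrite -(subrK S a) rmorphD -addrA fS fps_coefB.
rewrite (rv n.+1) // subr0.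
have h0 : fps_coef (fps_subst T) 0 = 0 by rewrite fps_substX.
by rewrite (morph_vanish h0 aS).
Qed.

Lemma nott_of_series : exists f : nottingham p, f T = s.
Proof.
have bij : bijective fps_subst.
  pose g b := sval (cid (fps_subst_surj b)).
  have gK : cancel g fps_subst by move=> b; rewrite /g; case: cid.
  by exists g => // a; apply: fps_subst_inj; rewrite gK.
have aut : normalised_automorphism fps_subst.
  split; [exact: fps_subst_zmod | exact: fps_subst_monoid | exact: bij |].
  by split; have := fps_substX => /(congr1 (@fps_coef F)) ->.
by exists (Nottingham aut); apply: fps_substX.
Qed.

End Series.

(** The coefficient c + a^2 compensates for the correction in [subtop]. *)
Lemma nott_direction_ex (a c : 'F_p) :
  exists f : nottingham p, top f 1 = a /\ subtop f 1 = c.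
Proof.
pose s := fpsX 'F_p + fps_const a * fpsX 'F_p ^+ 2 +
  fps_const (c + a ^+ 2) * fpsX 'F_p ^+ 3.
have sE i : fps_coef s i = (i == 1%N)%:R + a * (i == 2)%:R + (c + a ^+ 2) * (i == 3)%:R.
  by rewrite 2!fps_coefD !fps_constM !fps_coefXn.
have [||f fE] := @nott_of_series s; rewrite ?sE ?mulr0 ?addr0 //.
exists f; rewrite /subtop /sq_top /top fE !sE /= !(mulr0, mulr1, addr0, add0r).
by rewrite addrK.
Qed.

End Substitution.

(** * Beauville structures *)

Section Beauville.
Local Open Scope ring_scope.
Variables (p : nat) (p_prime : prime p) (p_gt2 : (2 < p)%N).
Notation F := 'F_p.
Notation N := (nottingham p).
Implicit Types f g h : N.

Definition dir f : F * F := (top f 1, subtop f 1).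

Lemma dirM f g : dir (f * g)%g = dir f + dir g.
Proof. by rewrite /dir topM ?subtopM ?nott_sub1_full. Qed.

Lemma dirV f : dir (f^-1)%g = - dir f.
Proof. by rewrite /dir topV ?subtopV ?nott_sub1_full. Qed.

Lemma dirJ f g : dir (f ^ g)%g = dir f.
Proof. by rewrite /conjg !dirM dirV addrCA addNr addr0. Qed.

Lemma mem_Sigma (gT : finGroupType) (x y w : gT) :
  reflect (exists2 z, z \in [:: x; y; (x * y)%g] & exists (u : gT) i, w = ((z ^ u) ^+ i)%g)
    (w \in beauville_Sigma [set: gT]%G x y).
Proof.
apply: (iffP bigcupP) => [[u _]|[z zxy [u [i ->]]]].
  rewrite !inE => /orP[/orP[]|]; rewrite -cycleJ => /cycleP[i ->].
  - by exists x; [rewrite !inE eqxx | exists u, i].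
  - by exists y; [rewrite !inE eqxx orbT | exists u, i].
  - by exists (x * y)%g; [rewrite !inE eqxx !orbT | exists u, i].
exists u; first by rewrite inE.
move: zxy; rewrite !inE => /or3P[] /eqP ->; rewrite -!cycleJ mem_cycle ?orbT //.
Qed.

(** Conjugation does not change the direction, so only the three directions of
    the triple remain of Sigma. *)
Lemma mem_Sigma_dir k f1 f2 w :
  w \in beauville_Sigma [set: nott_quo p k]%G (ncoset k f1) (ncoset k f2) ->
  exists f i, w = ncoset k (f ^+ i)%g /\ dir f \in [:: dir f1; dir f2; dir f1 + dir f2].
Proof.
move=> /mem_Sigma[z zf [u [i ->]]]; have [g ->] := ncoset_ex u.
have [f -> fd] : exists2 f, z = ncoset k f & dir f \in [:: dir f1; dir f2; dir f1 + dir f2].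
  move: zf; rewrite -ncosetM -dirM !inE => /or3P[] /eqP ->.
  - by exists f1 => //; rewrite !inE eqxx ?orbT.
  - by exists f2 => //; rewrite !inE eqxx ?orbT.
  - by exists (f1 * f2)%g => //; rewrite !inE eqxx ?orbT.
by exists (f ^ g)%g, i; rewrite dirJ ncosetX ncosetJ.
Qed.

Lemma ncoset_pow_top n f g : (0 < n)%N -> f \in nott_sub n -> top f n != 0 ->
  g \in nott_sub n -> exists e, ncoset n.+1 g = ncoset n.+1 (f ^+ e)%g.
Proof.
move=> n_gt0 fn f0 gn; exists (val (top g n / top f n)).
apply/ncosetP; apply: nott_subS; rewrite ?nott_subM ?nott_subV ?nott_subX //.
by rewrite topM ?nott_subV ?nott_subX // topV // topX // natr_Zp divfK // addNr.
Qed.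

(** The power of the hypothesis generates N_n / N_(n+1), which has order p; so
    that subgroup is common to all the sets Sigma. *)
Lemma not_beauville n : (0 < n)%N ->
  (forall f1 f2, <<[set ncoset n.+1 f1; ncoset n.+1 f2]>>%g = [set: nott_quo p n.+1] ->
    exists2 f, f \in [:: f1; f2; (f1 * f2)%g] &
      exists2 e, (f ^+ e)%g \in nott_sub n & top (f ^+ e)%g n != 0) ->
  ~ beauville_group [set: nott_quo p n.+1]%G.
Proof.
move=> n_gt0 power [_ [x1 [y1 [x2 [y2 []]]]]].
have [f1 ->] := ncoset_ex x1; have [g1 ->] := ncoset_ex y1.
have [f2 ->] := ncoset_ex x2; have [g2 ->] := ncoset_ex y2.
move=> /power[h1 h1in [e1 he1 te1]] /power[h2 h2in [e2 he2 te2]] S12.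
have [d E] := ncoset_pow_top n_gt0 he2 te2 he1.
have inS f g h e : h \in [:: f; g; (f * g)%g] ->
    ncoset n.+1 (h ^+ e)%g \in
      beauville_Sigma [set: nott_quo p n.+1]%G (ncoset n.+1 f) (ncoset n.+1 g).
  move=> hin; apply/mem_Sigma; exists (ncoset n.+1 h).
    by rewrite -ncosetM; move: hin; rewrite !inE => /or3P[] /eqP ->; rewrite eqxx ?orbT.
  by exists 1%g, e; rewrite conjg1 ncosetX.
have : ncoset n.+1 (h1 ^+ e1)%g \in (1%g : {set nott_quo p n.+1}).
  by rewrite -S12 inE inS //= E -expgM inS.
rewrite inE ncoset_eq1 => h; by rewrite (top_eq0 n_gt0 h) eqxx in te1.
Qed.

Lemma not_beauville_break m : ~ beauville_group [set: nott_quo p (break p m).+1]%G.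
Proof.
apply: not_beauville (break_gt0 p m) _ => f1 f2 gen.
have topE (f g : N) : top (f * g)%g 1 = top f 1 + top g 1 by rewrite topM ?nott_sub1_full.
have subtopE (f g : N) : subtop (f * g)%g 1 = subtop f 1 + subtop g 1.
  by rewrite subtopM ?nott_sub1_full.
have gen_top : ~ (top f1 1 = 0 /\ top f2 1 = 0).
  move=> [a1 a2]; have [f [fa _]] := nott_direction_ex (1 : F) 0.
  have top0 := morph_generators topE _ gen a1 a2.
  move: fa; rewrite top0 => [/eqP|h hk]; first by rewrite eq_sym oner_eq0.
  by apply: top_eq0 => //; apply: nott_sub_le hk; rewrite ltnS break_gt0.
case: m gen => [|m] gen.
  (* N / N_2 has order p, so any generator will do. *)
  have [a1|a1] := eqVneq (top f1 1) 0.
    exists f2; first by rewrite !inE eqxx orbT.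
    exists 1%N; rewrite expg1 ?nott_sub1_full //; apply/eqP => a2; exact: gen_top.
  by exists f1; rewrite ?inE ?eqxx //; exists 1%N; rewrite expg1 ?nott_sub1_full.
have gen_subtop : ~ (subtop f1 1 = 0 /\ subtop f2 1 = 0).
  move=> [c1 c2]; have [f [_ fc]] := nott_direction_ex (0 : F) 1.
  have subtop0 := morph_generators subtopE _ gen c1 c2.
  move: fc; rewrite subtop0 => [/eqP|h hk]; first by rewrite eq_sym oner_eq0.
  have h3 : h \in nott_sub 3.
    apply: nott_sub_le hk; rewrite ltnS.
    by apply: leq_ltn_trans (break_lt p_gt2 m); apply: break_gt0.
  have h2 : h \in nott_sub 2 by apply: nott_sub_le h3.
  have -> : subtop h 1 = top h 2 by rewrite /subtop /sq_top /= (top_eq0 _ h2) // expr0n subr0.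
  exact: top_eq0.
have good f : f \in [:: f1; f2; (f1 * f2)%g] -> top f 1 != 0 -> subtop f 1 != 0 ->
    exists2 f, f \in [:: f1; f2; (f1 * f2)%g] & exists2 e,
    (f ^+ e)%g \in nott_sub (break p m.+1) & top (f ^+ e)%g (break p m.+1) != 0.
  move=> fin a0 c0; exists f => //; exists (p ^ m.+1)%N.
    by have [] := expg_break p_prime p_gt2 m.+1 a0 c0.
  by have [] := expg_break p_prime p_gt2 m.+1 a0 c0.
(* If none of the three is good, f1 and f2 lie on the axes and so does their
   sum, hence both are on the same axis. *)
have := good f1; have := good f2; have := good (f1 * f2)%g.
rewrite topE subtopE !inE !eqxx ?orbT /=.
have [a1|a1] := eqVneq (top f1 1) 0; have [c1|c1] := eqVneq (subtop f1 1) 0;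
  have [a2|a2] := eqVneq (top f2 1) 0; have [c2|c2] := eqVneq (subtop f2 1) 0;
  rewrite ?a1 ?a2 ?c1 ?c2 ?add0r ?addr0 ?eqxx => g3 g2 g1;
  do [ by case: gen_top | by case: gen_subtop | exact: g1 | exact: g2 | exact: g3 ].
Qed.

Lemma break_between k : (3 <= k)%N -> (forall m, (1 <= m)%N -> k <> znum p m) ->
  exists m, (znum p m < k < znum p m.+1)%N.
Proof.
move=> k_ge3 kz.
have ltm m : (m < break p m)%N.
  by elim: m => // m IHm; apply: leq_ltn_trans IHm (break_lt p_gt2 m).
have ex : exists m, (k < znum p m.+1)%N.
  exists k; rewrite znum_break //; have := ltm k.+1; lia.
case: (ex_minnP ex) => [[|m]] lt_k min_m.
  by exists 0%N; rewrite lt_k andbT znum_break.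
exists m.+1; rewrite lt_k andbT ltn_neqAle; apply/andP; split.
  by apply/eqP => e; apply: (kz m.+1).
by rewrite leqNgt; apply/negP => /min_m; rewrite ltnn.
Qed.

Lemma beauville_between m k :
  (3 < p)%N -> (3 <= k)%N -> (znum p m < k)%N -> (k < znum p m.+1)%N ->
  beauville_group [set: nott_quo p k]%G.
Proof.
move=> p_gt3 k_ge3 lt_mk lt_km.
have [x [xa xc]] := nott_direction_ex (1 : F) 0.
have [y [ya yc]] := nott_direction_ex (0 : F) 1.
have dx : dir x = (1, 0) by rewrite /dir xa xc.
have dy : dir y = (0, 1) by rewrite /dir ya yc.
pose x2 := (x * (y * y))%g; pose y2 := (x * y^-1)%g.
(* The determinant of these two directions is -3: p > 3 is needed. *)
have dx2 : dir x2 = (1, 2%:R).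
  by rewrite !dirM dx dy; congr pair => /=; ring.
have dy2 : dir y2 = (1, -1).
  by rewrite !dirM dirV dx dy; congr pair => /=; ring.
have two0 : 2%:R != 0 :> F by rewrite natrF_eq0 // gtnNdvd.
have three0 : 3%:R != 0 :> F by rewrite natrF_eq0 // gtnNdvd.
have gen f g a c a' c' : dir f = (a, c) -> dir g = (a', c') -> a * c' - a' * c != 0 ->
    <<[set ncoset k f; ncoset k g]>>%g = [set: nott_quo p k].
  move=> [<- <-] [<- <-]; rewrite subr_eq0 => det0.
  apply: (independent_generate p_prime p_gt2 (H := <<_>>%G) _ _ det0).
    by apply: mem_gen; rewrite !inE eqxx.
  by apply: mem_gen; rewrite !inE eqxx orbT.
have gen1 : <<[set ncoset k x; ncoset k y]>>%g = [set: nott_quo p k].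
  by apply: (gen _ _ _ _ _ _ dx dy); rewrite mulr1 mulr0 subr0 oner_eq0.
have gen2 : <<[set ncoset k x2; ncoset k y2]>>%g = [set: nott_quo p k].
  apply: (gen _ _ _ _ _ _ dx2 dy2).
  by rewrite (_ : _ - _ = - 3%:R) ?oppr_eq0 //; ring.
split.
  apply/trivgPn; exists (ncoset k x) => //; rewrite ncoset_eq1.
  apply/negP => xk; have := top_eq0 (ltn0Sn 0) (nott_sub_le (ltnW k_ge3) xk).
  by move/eqP; rewrite xa oner_eq0.
exists (ncoset k x), (ncoset k y), (ncoset k x2), (ncoset k y2); split=> //.
apply/eqP; rewrite eqEsubset sub1set; apply/andP; split; last first.
  have one u v : 1%g \in beauville_Sigma [set: nott_quo p k]%G u v.
    by apply/mem_Sigma; exists u; [rewrite inE eqxx | exists 1%g, 0%N].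
  by rewrite inE !one.
apply/subsetP => w; rewrite !inE.
move=> /andP[/mem_Sigma_dir[f1 [i [wi d1]]] /mem_Sigma_dir[f2 [j [wj d2]]]].
apply: contraT => w1.
have cc : (dir f2).1 != 0 -> (dir f2).2 != 0 ->
    (dir f2).1 * (dir f1).2 = (dir f1).1 * (dir f2).2.
  move=> a2 c2.
  apply: (cyclic_meet_direction p_prime p_gt2 a2 c2 lt_mk lt_km (i := j) (j := i)).
    by rewrite -wj.
  by rewrite -wi -wj.
have nz c : c \in [:: 1; -1; 2%:R; - 2%:R] -> c != 0 :> F.
  by rewrite !inE => /or4P[] /eqP ->; rewrite ?oppr_eq0 ?oner_eq0.
have sum1 : (1, 0) + (0, 1) = (1, 1) :> F * F by congr pair => /=; ring.
have sum2 : (1, 2%:R) + (1, -1) = (2%:R, 1) :> F * F by congr pair => /=; ring.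
move: cc d1 d2; rewrite dx dy dx2 dy2 sum1 sum2 !inE.
case: (dir f1) (dir f2) => [a1 c1] [a2 c2] /= cc d1 d2.
suff /and3P[a2_neq0 c2_neq0] : [&& a2 != 0, c2 != 0 & a2 * c1 - a1 * c2 != 0].
  by rewrite (cc a2_neq0 c2_neq0) subrr eqxx.
have nz1 : a2 * c1 - a1 * c2 \in [:: 1; -1; 2%:R; - 2%:R].
  move: d1 d2; rewrite !inE => /or3P[] /eqP[-> ->] /or3P[] /eqP[-> ->];
    rewrite ?(mulr0, mul0r, mulr1, mul1r, subr0, sub0r, opprK, mulrN1, eqxx, orbT) //.
    by rewrite (_ : 1 - 2%:R = -1) ?eqxx ?orbT //; ring.
  by rewrite (_ : 2%:R - 1 = 1) ?eqxx //; ring.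
by rewrite (nz _ nz1) andbT; case/or3P: d2 => /eqP[-> ->]; rewrite !nz ?inE ?eqxx ?orbT.
Qed.

End Beauville.

Theorem theorem3p7 (p : nat) (p_prime : prime p) (p_ge5 : 5 <= p)
  (k : nat) (k_ge1 : 1 <= k) :
  beauville_group [set: nott_quo p k]%G <->
  (3 <= k /\ forall m : nat, 1 <= m -> k <> znum p m).
Proof.
have p_gt3 : (3 < p)%N by apply: ltnW.
have p_gt2 := ltnW p_gt3.
split=> [beau | [k_ge3 kz]]; last first.
  have [m /andP[lt_mk lt_km]] := break_between p_prime p_gt2 k_ge3 kz.
  exact: (beauville_between p_prime p_gt2 p_gt3 k_ge3 lt_mk lt_km).
have kz m : k <> znum p m.
  rewrite znum_break // => def_k.
  by apply: (not_beauville_break p_prime p_gt2 (m := m)); rewrite -def_k.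
split=> //; case: k k_ge1 beau kz => [|[|[|k]]] // _ beau kz; last first.
  (* The value z_0 = 2 is also excluded. *)
  by case: (kz 0%N); rewrite znum_break.
case: beau => /trivgPn[u _ /negP[]]; have [f ->] := ncoset_ex u.
by rewrite ncoset_eq1 nott_sub1_full.
Qed.
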